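(* For every positive integer $k$, there is no graph homomorphism from the Kneser graph $KG_{2k+1,k}$ to the $5$-cycle graph $C_5$.
   Context: A graph homomorphism $G\to H$ is a map $V(G)\to V(H)$ sending adjacent vertices to adjacent vertices. The Kneser graph $KG_{2k+1,k}$ has as vertices the $k$-element subsets of $\{0,1,\dots,2k\}$, two of them being adjacent if and only if they are disjoint. $C_5$ is the graph with vertex set $\mathbb{Z}/5$ in which $x$ is adjacent exactly to $x\pm1$. *)

(* Defs.v *)
From mathcomp Require Import all_boot all_algebra.
Set Implicit Arguments.
Unset Strict Implicit.
Unset Printing Implicit Defensive.

(* A graph is given by its vertex type together with its adjacency relation. *)
Definition graph_hom (V W : Type) (e : rel V) (e' : rel W) (f : V -> W) : Prop :=
  forall x y : V, e x y -> e' (f x) (f y).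

Definition kneser_vertex (n k : nat) : Type := {A : {set 'I_n} | #|A| == k}.

(* For k = 0 this relation is reflexive; it is a simple graph when 0 < k. *)
Definition kneser_adj (n k : nat) : rel (kneser_vertex n k) :=
  fun A B => [disjoint val A & val B].

Definition C5_adj : rel 'Z_5 :=
  fun x y => ((y == x + 1) || (y == x - 1))%R.

(* Main.v *)
Require Import Defs.
From mathcomp Require Import all_boot all_algebra.
From mathcomp Require Import zify.
Set Implicit Arguments.
Unset Strict Implicit.
Unset Printing Implicit Defensive.
Import GRing.Theory.

(** A homomorphism [g] to the 5-cycle sends every closed walk to a closed walk
of [C_5], which has a winding number.  The idea is that short even closed walks
do not wind, that in this Kneser graph they generate all even closed walks, and
that the double of an odd closed walk nevertheless winds.

Two [k]-sets that differ by one exchange have a common neighbour, so their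
values under [g] differ by [0], [2] or [-2] mod 5; lift this difference to the
same even integer.  Around a triangle of the Johnson graph the three lifts sum
to an even multiple of 5 of absolute value at most 6, hence to 0
([even_lift_add]).  Every function on Johnson edges that vanishes around
triangles is a difference of potentials ([johnson_cocycle_exact]: the Johnson
graph is simply connected once its triangles are filled in).  This yields
integers [F A], all of the same parity, lifting [g] up to a constant.

For disjoint [A] and [B], the defect [c A B] is [F B - F A] minus the lift [1]
or [-1] of [g B - g A].  It is odd and antisymmetric.  It does not change when
[B] is replaced by another [k]-set disjoint from [A], since two such sets are
Johnson-adjacent; connectivity of the Johnson graph ([johnson_connected]) then
makes it independent of both [A] and [B].  Being antisymmetric, it is 0, which
is not odd. *)

(** * Connectivity of the Johnson graph *)

Section Johnson.
Variable T : finType.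
Implicit Types (U W A B C X : {set T}) (k : nat).

Definition ksubsets U k : {set {set T}} := [set A : {set T} | A \subset U & #|A| == k].

(** For sets of equal size this is Johnson adjacency or equality; keeping the
reflexive case spares the proofs below from separating coinciding vertices. *)
Definition johnson_adj A B : bool := #|A :\: B| <= 1.

Lemma ksubsetsP U k A :
  reflect (A \subset U /\ #|A| = k) (A \in ksubsets U k).
Proof. by rewrite inE; apply: (iffP andP) => -[AU /eqP]. Qed.

Lemma exists_ksubset U k : k <= #|U| -> exists A, A \in ksubsets U k.
Proof.
move=> kU; apply/set0Pn; rewrite -card_gt0.
by rewrite cards_draws bin_gt0.
Qed.

Lemma card_setD_eq A B : #|A| = #|B| -> #|A :\: B| = #|B :\: A|.
Proof. by move=> eAB; rewrite !cardsD eAB setIC. Qed.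

Lemma johnson_adjxx A : johnson_adj A A.
Proof. by rewrite /johnson_adj setDv cards0. Qed.

Lemma johnson_adj_sym A B : #|A| = #|B| -> johnson_adj A B = johnson_adj B A.
Proof. by move=> eAB; rewrite /johnson_adj card_setD_eq. Qed.

Lemma johnson_adj_add x y A : johnson_adj (x |: A) (y |: A).
Proof.
rewrite /johnson_adj -(cards1 x) subset_leq_card //.
by apply/subsetP=> z; rewrite !inE; case: (z == x) => //=; case: (z \in A); rewrite ?orbT ?andbF.
Qed.

Lemma johnson_adj_exchange A B : #|A| = #|B| -> johnson_adj A B -> A != B ->
  exists a b, [/\ a \notin B, b \notin A, a \in A, b \in B & a |: B = b |: A].
Proof.
move=> eAB adj neq.
have A1 : #|A :\: B| = 1.
  apply/eqP; rewrite eqn_leq [(_ <= 1)%N]adj card_gt0 setD_eq0.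
  by apply: contra neq => AB; rewrite eqEcard AB eAB leqnn.
have B1 : #|B :\: A| = 1 by rewrite -card_setD_eq.
have /cards1P [a ea] : #|A :\: B| == 1 by rewrite A1.
have /cards1P [b eb] : #|B :\: A| == 1 by rewrite B1.
have: a \in A :\: B by rewrite ea set11.
have: b \in B :\: A by rewrite eb set11.
rewrite !inE => /andP[bA bB] /andP[aB aA].
exists a, b; split=> //.
by rewrite -ea -eb; apply/setP=> z; rewrite !inE; case: (z \in A); case: (z \in B).
Qed.

(** Connectivity as an induction principle: exchanging an element of [A] outside
[B] for an element of [B] outside [A] brings [A] closer to [B]. *)
Lemma johnson_connected U k (P : {set T} -> Prop) A :
  A \in ksubsets U k -> P A ->
  (forall B C, B \in ksubsets U k -> C \in ksubsets U k ->
     johnson_adj B C -> P B -> P C) ->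
  forall B, B \in ksubsets U k -> P B.
Proof.
move=> AU PA step B BU.
have [m] := ubnP #|B :\: A|; elim: m A AU PA => // m IHm A AU PA.
have [AsU cA] := ksubsetsP _ _ _ AU; have [BsU cB] := ksubsetsP _ _ _ BU.
have [/eqP B0 _|] := posnP #|B :\: A|.
  suff -> : B = A by [].
  by apply/eqP; rewrite eqEcard cA cB leqnn andbT -setD_eq0 -cards_eq0.
move=> posBA ltm; have := posBA; rewrite -card_setD_eq ?cA ?cB //.
move: posBA; rewrite !card_gt0 => /set0Pn[b]; rewrite !inE => /andP[bA bB].
case/set0Pn=> a; rewrite !inE => /andP[aB aA].
pose A' := b |: (A :\ a).
have A'U : A' \in ksubsets U k.
  apply/ksubsetsP; split.
    apply/subsetP=> z; rewrite !inE => /orP[/eqP->|/andP[_ zA]].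
      exact: (subsetP BsU).
    exact: (subsetP AsU).
  by rewrite cardsU1 !inE negb_and bA orbT -cA (cardsD1 a A) aA.
apply: (IHm A') => //.
  apply: (step A) => //; rewrite -{1}(setD1K aA).
  exact: johnson_adj_add.
rewrite -ltnS; apply: leq_trans ltm; rewrite ltnS; apply: proper_card.
apply/properP; split.
  apply/subsetP=> z; rewrite !inE negb_or => /andP[/andP[zb zA] zB].
  rewrite zB andbT; move: zA; rewrite negb_and negbK => /orP[/eqP za|//].
  by move: aB; rewrite -za zB.
by exists b; rewrite !inE ?bA ?bB ?eqxx.
Qed.

(** * Triangle cocycles on the Johnson graph are exact *)

Local Open Scope ring_scope.

(** Since [johnson_adj] is reflexive, degenerate triangles are included, and they
force [d] to vanish on the diagonal and to be antisymmetric. *)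
Definition is_cocycle (V : zmodType) U k (d : {set T} -> {set T} -> V) : Prop :=
  forall A B C, A \in ksubsets U k -> B \in ksubsets U k -> C \in ksubsets U k ->
    johnson_adj A B -> johnson_adj B C -> johnson_adj A C ->
    d A B + d B C = d A C.

Lemma cocycle_diag (V : zmodType) U k (d : {set T} -> {set T} -> V) A :
  is_cocycle U k d -> A \in ksubsets U k -> d A A = 0.
Proof.
move=> dC AU; have aA := johnson_adjxx A.
by apply: (addrI (d A A)); rewrite addr0 (dC A A A).
Qed.

Lemma cocycle_anti (V : zmodType) U k (d : {set T} -> {set T} -> V) A B :
  is_cocycle U k d -> A \in ksubsets U k -> B \in ksubsets U k ->
  johnson_adj A B -> d A B = - d B A.
Proof.
move=> dC AU BU aAB; apply/eqP; rewrite -addr_eq0; apply/eqP.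
have [_ cA] := ksubsetsP _ _ _ AU; have [_ cB] := ksubsetsP _ _ _ BU.
by rewrite (dC A B A) ?johnson_adjxx ?(cocycle_diag dC) // johnson_adj_sym // cA cB.
Qed.

Lemma ksubsetsU1 n U k A : n \in U -> A \in ksubsets (U :\ n) k ->
  n |: A \in ksubsets U k.+1.
Proof.
move=> nU /ksubsetsP[/subsetD1P[AU nA] cA]; apply/ksubsetsP; split.
  by rewrite subUset sub1set nU.
by rewrite cardsU1 nA cA.
Qed.

Lemma ksubsetsD1 n U k A : n \in A -> A \in ksubsets U k.+1 ->
  A :\ n \in ksubsets (U :\ n) k.
Proof.
move=> nA /ksubsetsP[AU cA]; apply/ksubsetsP; split; first exact: setSD.
by move: cA; rewrite (cardsD1 n A) nA => -[].
Qed.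

Lemma ksubsetsS U W k A : U \subset W -> A \in ksubsets U k -> A \in ksubsets W k.
Proof.
move=> UW /ksubsetsP[AU cA]; apply/ksubsetsP; split=> //.
exact: subset_trans UW.
Qed.

Lemma johnson_adjU1 n A B : n \notin A ->
  johnson_adj (n |: A) (n |: B) = johnson_adj A B.
Proof.
move=> nA; rewrite /johnson_adj; suff -> : (n |: A) :\: (n |: B) = A :\: B by [].
apply/setP=> z; rewrite !inE; case: eqP => [->|//].
by rewrite (negPf nA) andbF.
Qed.

(** Induction on the ground set.  Fix [n] in [U]: the [k]-sets avoiding [n] and
those containing [n] form smaller Johnson graphs, with potentials [F0] and [F1].
On an edge from [n |: A] to [x |: A] joining the two, the mismatch is [D A x].
Triangles with two vertices on one side show that [D] takes the same value on
neighbouring cross edges, and connectivity makes it a constant [c]; shifting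
[F1] by [c] glues the two potentials. *)
Lemma johnson_cocycle_exact (V : zmodType) U k (d : {set T} -> {set T} -> V) :
  is_cocycle U k d ->
  exists F : {set T} -> V, forall A B,
    A \in ksubsets U k -> B \in ksubsets U k -> johnson_adj A B ->
    d A B = F B - F A.
Proof.
have [m] := ubnP #|U|; elim: m U k d => // m IHm U k d ltUm dC.
case: k dC => [|k] dC.
  exists (fun=> 0) => A B AU BU _; rewrite subrr.
  have [_ /cards0_eq A0] := ksubsetsP _ _ _ AU.
  have [_ /cards0_eq B0] := ksubsetsP _ _ _ BU.
  by rewrite B0 -{1}A0 A0 (cocycle_diag dC) // -A0.
have [U0|[n nU]] := set_0Vmem U.
  exists (fun=> 0) => A B /ksubsetsP[]; rewrite U0 subset0 => /eqP->.
  by rewrite cards0.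
pose U' := U :\ n.
have U'U : U' \subset U by exact: subsetDl.
have ltU'm : (#|U'| < m)%N by move: ltUm; rewrite (cardsD1 n U) nU.
have nin A j : A \in ksubsets U' j -> n \notin A.
  by case/ksubsetsP=> /subsetD1P[].
have [F0 F0E] : exists F0 : {set T} -> V, forall A B,
    A \in ksubsets U' k.+1 -> B \in ksubsets U' k.+1 -> johnson_adj A B ->
    d A B = F0 B - F0 A.
  apply: IHm => // A B C AU BU CU; apply: dC; exact: ksubsetsS U'U _.
have [F1 F1E] : exists F1 : {set T} -> V, forall A B,
    A \in ksubsets U' k -> B \in ksubsets U' k -> johnson_adj A B ->
    d (n |: A) (n |: B) = F1 B - F1 A.
  apply: (IHm U' k (fun A B => d (n |: A) (n |: B))) => // A B C AU BU CU *.
  by apply: dC; rewrite ?johnson_adjU1 ?ksubsetsU1 ?(nin _ k).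
pose D A x := F0 (x |: A) - (F1 A + d (n |: A) (x |: A)).
pose valid A x := (A \in ksubsets U' k) && (x \in U' :\: A).
have xAU A x : valid A x -> x |: A \in ksubsets U' k.+1.
  case/andP=> /ksubsetsP[AU cA]; rewrite inE => /andP[xA xU].
  by apply/ksubsetsP; rewrite subUset sub1set xU AU cardsU1 xA cA.
have DE u v w : w - u = v - (u + (v - w)) :> V.
  by rewrite opprD opprB addrCA [v + _]addrC subrK addrC.
(* Triangle n |: A, x |: A, y |: A: one vertex contains n. *)
have Dx A x y : valid A x -> valid A y -> D A x = D A y.
  move=> vx vy; have /andP[AU _] := vx.
  have -> : D A y = F0 (y |: A) - ((F1 A + d (n |: A) (x |: A)) +
                                   (F0 (y |: A) - F0 (x |: A))).
    rewrite -F0E ?xAU ?johnson_adj_add // -addrA (dC (n |: A)) ?johnson_adj_add //.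
    - exact: ksubsetsU1.
    - by apply: (ksubsetsS U'U); apply: xAU.
    - by apply: (ksubsetsS U'U); apply: xAU.
  exact: DE.
(* Triangle n |: A, n |: B, a |: B = b |: A: two vertices contain n. *)
have Dex A B a b : valid A b -> valid B a -> johnson_adj A B ->
    a |: B = b |: A -> D B a = D A b.
  move=> vA vB aAB eX; have /andP[AU _] := vA; have /andP[BU _] := vB.
  rewrite /D eX; congr (_ - _).
  have <- : d (n |: A) (n |: B) + d (n |: B) (b |: A) = d (n |: A) (b |: A).
    have XU : b |: A \in ksubsets U k.+1 by apply: (ksubsetsS U'U); apply: xAU.
    apply: dC; rewrite ?johnson_adjU1 ?(ksubsetsU1 nU) ?(nin _ k) ?johnson_adj_add //.
    by rewrite -eX johnson_adj_add.
  by rewrite F1E // addrA [F1 A + _]addrC subrK.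
have Dconst A x B y : valid A x -> valid B y -> D A x = D B y.
  move=> vx /[dup] vy /andP[BU _]; have /andP[AU _] := vx.
  pose P B := forall y, valid B y -> D A x = D B y.
  suff: P B by apply.
  apply: (johnson_connected AU) BU => [z vz|B' C B'U CU adj PB z vz].
    exact: Dx.
  have [eBC|neq] := eqVneq B' C; first by rewrite -eBC; apply: PB; rewrite eBC.
  have [B'sU cB] := ksubsetsP _ _ _ B'U; have [CsU cC] := ksubsetsP _ _ _ CU.
  have cBC : #|B'| = #|C| by rewrite cB cC.
  have [a [b [aC bB aB bC eX]]] := johnson_adj_exchange cBC adj neq.
  have va : valid C a by rewrite /valid CU inE aC (subsetP B'sU).
  have vb : valid B' b by rewrite /valid B'U inE bB (subsetP CsU).
  by rewrite (PB b vb) (Dx C z a) // (Dex B' C a b).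
(* There is no cross edge at all when U :\ n has at most k elements; then any c
   will do. *)
have [c cE] : exists c, forall A x, valid A x -> D A x = c.
  case: (pickP (fun p : {set T} * T => valid p.1 p.2)) => [[A x] /= vx|no].
    by exists (D A x) => B y vy; apply: Dconst.
  by exists 0 => A x vx; have := no (A, x); rewrite /= vx.
pose F X := if n \in X then F1 (X :\ n) + c else F0 X.
have mixed A B : A \in ksubsets U k.+1 -> B \in ksubsets U k.+1 ->
    johnson_adj A B -> n \in A -> n \notin B -> d A B = F B - F A.
  move=> AU BU aAB nA nB; rewrite /F nA (negPf nB).
  have [_ cA] := ksubsetsP _ _ _ AU; have [BsU cB] := ksubsetsP _ _ _ BU.
  have A0U := ksubsetsD1 nA AU.
  have neq : A != B by apply: contraNneq nB => <-.
  have cAB : #|A| = #|B| by rewrite cA cB.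
  have [a [b [aB bA aA bB eX]]] := johnson_adj_exchange cAB aAB neq.
  have ean : a = n.
    have : n \in a |: B by rewrite eX !inE nA orbT.
    by rewrite !inE (negPf nB) orbF => /eqP.
  have eB : B = b |: (A :\ n).
    have -> : B = (a |: B) :\ n by rewrite ean setU1K.
    rewrite eX; apply/setP=> z; rewrite !inE.
    by case: (z =P n) => //= ->; apply/esym/negbTE; rewrite orbF; apply: contraNneq bA => <-.
  have vb : valid (A :\ n) b.
    rewrite /valid A0U !inE negb_and bA orbT (subsetP BsU) // andbT.
    by apply: contraNneq bA => ->.
  by rewrite -(cE _ _ vb) /D setD1K // -eB -DE addrC addKr.
exists F => A B AU BU aAB.
have [_ cA] := ksubsetsP _ _ _ AU; have [_ cB] := ksubsetsP _ _ _ BU.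
have [nA|nA] := boolP (n \in A); have [nB|nB] := boolP (n \in B).
- rewrite /F nA nB opprD addrACA subrr addr0 -F1E ?ksubsetsD1 ?setD1K //.
  by rewrite -(@johnson_adjU1 n) ?setD1K // !inE eqxx.
- exact: mixed.
- by rewrite (cocycle_anti dC) // mixed ?opprB // johnson_adj_sym // cA cB.
- have inU' X : X \in ksubsets U k.+1 -> n \notin X -> X \in ksubsets U' k.+1.
    by case/ksubsetsP=> XU cX nX; apply/ksubsetsP; rewrite subsetD1 XU nX.
  by rewrite /F (negPf nA) (negPf nB) F0E ?inU'.
Qed.

(** * Johnson adjacency inside the Kneser graph *)

(** The union of two Johnson-adjacent [k]-sets has at most [k + 1] elements,
which leaves room for a [k]-set among the remaining [k] or more points. *)
Lemma common_disjoint k A B : #|T| = (2 * k + 1)%N ->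
  A \in ksubsets setT k -> B \in ksubsets setT k -> johnson_adj A B ->
  exists C, [/\ C \in ksubsets setT k, [disjoint A & C] & [disjoint B & C]].
Proof.
move=> cT /ksubsetsP[_ cA] /ksubsetsP[_ cB] aAB.
have [C /ksubsetsP[CAB cC]] : exists C, C \in ksubsets (~: (A :|: B)) k.
  apply: exists_ksubset; have := cardsC (A :|: B); have := cardsUI A B.
  by move: aAB; rewrite /johnson_adj cardsD; lia.
exists C; split; first by apply/ksubsetsP.
  by rewrite disjoint_sym disjoints_subset (subset_trans CAB) // setCS subsetUl.
by rewrite disjoint_sym disjoints_subset (subset_trans CAB) // setCS subsetUr.
Qed.

(** Both sets lie in the complement of [A], which has only [k + 1] elements. *)
Lemma johnson_adj_codisjoint k A B C : #|T| = (2 * k + 1)%N ->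
  A \in ksubsets setT k -> B \in ksubsets setT k -> C \in ksubsets setT k ->
  [disjoint A & B] -> [disjoint A & C] -> johnson_adj B C.
Proof.
move=> cT /ksubsetsP[_ cA] /ksubsetsP[_ cB] /ksubsetsP[_ cC].
rewrite disjoint_sym disjoints_subset => BA; rewrite disjoint_sym disjoints_subset => CA.
apply: (leq_trans (subset_leq_card (setSD C BA))).
rewrite cardsD (setIidPr CA); have := cardsC A; lia.
Qed.

End Johnson.

(** * Integer lifts of steps in the 5-cycle *)

Section Lifts.
Local Open Scope ring_scope.

(** The lift of a single step of a walk in the 5-cycle; only the values at [1] and
[-1] are meaningful. *)
Definition odd_lift (u : 'Z_5) : int := if u == 1 then 1 else -1.

(** The lift of two consecutive steps; only the values on [even_step] are
meaningful. *)
Definition even_lift (u : 'Z_5) : int :=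
  if u == 2%:R then 2 else if u == - 2%:R then -2 else 0.

Definition even_step (u : 'Z_5) : bool := u \in [:: 0; 2%:R; - 2%:R].

(** Both sides are even and congruent mod 5, and they differ by at most 6, so they
agree: a multiple of 10 of that size is 0.  This is where the length 5 of the
cycle enters. *)
Lemma even_lift_add (u v : 'Z_5) : even_step u -> even_step v ->
  even_step (u + v) -> even_lift u + even_lift v = even_lift (u + v).
Proof.
by move: u v; do 2 (case=> [[|[|[|[|[|//]]]]] ?]).
Qed.

Lemma C5_adj_even_step (a x y : 'Z_5) :
  C5_adj x a -> C5_adj y a -> even_step (y - x).
Proof.
by move: a x y; do 3 (case=> [[|[|[|[|[|//]]]]] ?]).
Qed.

Lemma even_lift_sub (a x y : 'Z_5) : C5_adj a x -> C5_adj a y ->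
  even_lift (y - x) = odd_lift (y - a) - odd_lift (x - a).
Proof.
by move: a x y; do 3 (case=> [[|[|[|[|[|//]]]]] ?]).
Qed.

Lemma odd_lift_opp (x y : 'Z_5) : C5_adj x y ->
  odd_lift (x - y) = - odd_lift (y - x).
Proof.
by move: x y; do 2 (case=> [[|[|[|[|[|//]]]]] ?]).
Qed.

(** * Nonexistence of a homomorphism *)

(** It is convenient to let [g] be defined on all sets, with arbitrary values
outside the [k]-sets. *)
Lemma no_C5_labelling (T : finType) k (g : {set T} -> 'Z_5) :
  #|T| = (2 * k + 1)%N ->
  ~ (forall A B, A \in ksubsets setT k -> B \in ksubsets setT k ->
       [disjoint A & B] -> C5_adj (g A) (g B)).
Proof.
move=> cT homg; pose K := ksubsets [set: T] k.
have cK A : A \in K -> #|A| = k by case/ksubsetsP.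
have stepE A B : A \in K -> B \in K -> johnson_adj A B -> even_step (g B - g A).
  move=> AK BK aAB; have [C [CK AC BC]] := common_disjoint cT AK BK aAB.
  by apply: (@C5_adj_even_step (g C)); apply: homg.
have [F FE] : exists F : {set T} -> int, forall A B, A \in K -> B \in K ->
    johnson_adj A B -> even_lift (g B - g A) = F B - F A.
  apply: johnson_cocycle_exact => A B C AK BK CK aAB aBC aAC.
  have eAC : (g B - g A) + (g C - g B) = g C - g A by rewrite addrC addrA subrK.
  by rewrite even_lift_add ?eAC ?stepE.
pose c A B := F B - F A - odd_lift (g B - g A).
have c_right A B C : A \in K -> B \in K -> C \in K ->
    [disjoint A & B] -> [disjoint A & C] -> c A B = c A C.
  move=> AK BK CK AB AC.
  have := FE B C BK CK (johnson_adj_codisjoint cT AK BK CK AB AC).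
  by rewrite (@even_lift_sub (g A)) ?homg // /c; lia.
have c_sym A B : A \in K -> B \in K -> [disjoint A & B] -> c A B = - c B A.
  move=> AK BK AB; have := odd_lift_opp (homg A B AK BK AB).
  by rewrite /c; lia.
have [A0 A0K] : exists A, A \in K.
  by apply: exists_ksubset; rewrite cardsT cT; lia.
have [B0 [B0K AB0 _]] := common_disjoint cT A0K A0K (johnson_adjxx A0).
have c_const A B : A \in K -> B \in K -> [disjoint A & B] -> c A B = c A0 B0.
  move=> /[swap] BK AK; move: A AK B BK.
  apply: (johnson_connected A0K) => [B BK AB|A A' AK A'K aAA' IHA B BK AB].
    exact: c_right.
  have [C [CK AC A'C]] := common_disjoint cT AK A'K aAA'.
  rewrite (c_right A' B C) // c_sym // (c_right C A' A) // 1?disjoint_sym //.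
  by rewrite -c_sym ?IHA.
(* The lifts of Johnson steps are even, so F has constant parity. *)
have F_even A : A \in K -> exists z, F A - F A0 = z + z.
  move: A; apply: (johnson_connected A0K) => [|A B AK BK aAB [z zE]].
    by exists 0; lia.
  have := FE A B AK BK aAB; rewrite /even_lift.
  by case: ifP => _; [|case: ifP => _] => e;
    [exists (z + 1) | exists (z - 1) | exists z]; lia.
have [z zE] := F_even B0 B0K.
have := c_const B0 A0 B0K A0K; rewrite disjoint_sym => /(_ AB0).
rewrite (c_sym B0) // 1?disjoint_sym // /c /odd_lift.
by case: ifP => _; lia.
Qed.

End Lifts.

Theorem corollary5p11 (k : nat) (hk : 0 < k) :
  ~ exists f : kneser_vertex (2 * k + 1) k -> 'Z_5,
      graph_hom (@kneser_adj (2 * k + 1) k) C5_adj f.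
Proof.
case=> f homf.
pose g (A : {set 'I_(2 * k + 1)}) : 'Z_5 := if insub A is Some v then f v else 0%R.
apply: (@no_C5_labelling _ k g); first exact: card_ord.
move=> A B /ksubsetsP[_ /eqP cA] /ksubsetsP[_ /eqP cB] AB.
rewrite /g (insubT (fun X : {set _} => #|X| == k) cA).
rewrite (insubT (fun X : {set _} => #|X| == k) cB).
exact: homf.
Qed.
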